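(* Let $A$ be a circular $m\times n$ matrix with no dominating rows and let $\alpha$ be a positive integer. Then $Q^*(A,\alpha\mathbf{1})$ is equal to the set of points $x\in\mathbb{R}^n$ satisfying $Ax\ge \alpha\mathbf{1}$, $x\ge 0$, and all $\Gamma$-inequalities (with respect to $b=\alpha\mathbf{1}$) for the circuits $\Gamma$ of $D(A)$ that contain no reverse row arcs, satisfy $p(\Gamma)\ge 2$, and such that $p(\Gamma)$ does not divide $t(\Gamma,\alpha\mathbf{1})$.
   Context: $\mathbf{1}$ is the all-ones vector. Notation: $[n]=\{1,\dots,n\}$ with addition modulo $n$ (index $0$ identified with $n$); for $a,c\in[n]$ with $t\ge0$ minimal such that $a+t\equiv c\pmod n$, $[a,c]_n=\{a,\dots,a+t\}$ (mod $n$), $[a,c)_n=[a,c]_n\setminus\{c\}$. An $m\times n$ $\{0,1\}$-matrix $A$ is circular if for each row $i$ there are $\ell_i\in[n]$ and an integer $k_i$, $2\le k_i\le n-1$, such that row $i$ is the incidence vector of $[\ell_i,\ell_i+k_i)_n$. Row $i$ dominates row $\ell\ne i$ if $a_{ij}\ge a_{\ell j}$ for all $j$; $A$ has no dominating rows if no row dominates another. $Q(A,b)=\{x\in\mathbb{R}^n:Ax\ge b,x\ge0\}$, $Q^*(A,b)=\operatorname{conv}(Q(A,b)\cap\mathbb{Z}^n)$. $D(A)$: node set $[n]$ (labels mod $n$); forward row arcs $a_i=(\ell_i-1,\ell_i+k_i-1)$ ($i\in[m]$), forward short arcs $a_{m+j}=(j-1,j)$ ($j\in[n]$), reverse row arcs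 $\bar a_i=(\ell_i+k_i-1,\ell_i-1)$, reverse short arcs $\bar a_{m+j}=(j,j-1)$. Lengths $k_i$, $1$, $-k_i$, $-1$ respectively. A circuit is a simple directed circuit; its winding number $p(\Gamma)$ satisfies $p(\Gamma)n=\sum_{a\in E(\Gamma)}l(a)$. A forward row arc $a_i$ jumps over $j$ iff $j\in[\ell_i,\ell_i+k_i)_n$; $(j-1,j)$ jumps over $j$ only; a reverse arc $\bar a_k$ jumps over $j$ iff $a_k$ does; $p^-(\Gamma,j)$ = number of reverse arcs of $\Gamma$ jumping over $j$. For a circuit $\Gamma$ and $b\in\mathbb{Z}_+^m$: $t(\Gamma,b)=\sum_{i:a_i\in E(\Gamma)}b_i-\sum_{i:\bar a_i\in E(\Gamma)}b_i$; for $p(\Gamma)\ne0$, $\beta=\lfloor t(\Gamma,b)/p(\Gamma)\rfloor$, $r=t(\Gamma,b)-\beta p(\Gamma)$, and the $\Gamma$-inequality is $\sum_{j\in[n]}[p^-(\Gamma,j)+r]x_j\ge r(\beta+1)+\sum_{i:\bar a_i\in E(\Gamma)}b_i$. *)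

(* Defs.v *)
From HB Require Import structures.
From mathcomp Require Import all_boot all_order all_algebra.
Set Implicit Arguments.
Unset Strict Implicit.
Unset Printing Implicit Defensive.
Import Order.TTheory GRing.Theory Num.Theory.
Local Open Scope ring_scope.

(* Conventions: the index set [n] = {1,...,n} (mod n, 0 identified with n) is
   represented by 'I_n = {0,...,n-1}, label j in [n] being the residue j mod n.
   Row i of a circular matrix is encoded by l i : 'I_n (= l_i mod n) and
   k i : nat (= k_i).  Nodes of D(A) are natural numbers in [0,n) (residues). *)

Section CircularDigraph.
Variables (m n : nat) (l : 'I_m -> 'I_n) (k : 'I_m -> nat).

(* column c lies in [l_i, l_i + k_i)_n *)
Definition in_row (i : 'I_m) (c : 'I_n) : bool := ((c + n - l i) %% n < k i)%N.

Definition circular_data {R : nzRingType} (A : 'M[R]_(m, n)) : Prop :=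
  (forall i, (2 <= k i <= n.-1)%N) /\
  (forall i c, A i c = if in_row i c then 1 else 0).

Definition no_dominating_rows {R : numDomainType} (A : 'M[R]_(m, n)) : Prop :=
  forall i i' : 'I_m, i != i' -> ~ (forall j, A i' j <= A i j).

(* Arcs of D(A): (true, inl i) = a_i, (true, inr j) = a_{m+j} = (j-1, j),
   (false, _) = the corresponding reverse arcs. *)
Definition darc := (bool * ('I_m + 'I_n))%type.

Definition fwd_tail (a : 'I_m + 'I_n) : nat :=
  match a with
  | inl i => ((l i + n).-1 %% n)%N
  | inr j => ((j + n).-1 %% n)%N
  end.

Definition fwd_head (a : 'I_m + 'I_n) : nat :=
  match a with
  | inl i => ((l i + k i + n).-1 %% n)%N
  | inr j => (j %% n)%N
  end.

Definition arc_tail (e : darc) : nat := if e.1 then fwd_tail e.2 else fwd_head e.2.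
Definition arc_head (e : darc) : nat := if e.1 then fwd_head e.2 else fwd_tail e.2.

Definition fwd_len (a : 'I_m + 'I_n) : int :=
  match a with inl i => (k i)%:Z | inr _ => 1 end.

Definition arc_len (e : darc) : int := if e.1 then fwd_len e.2 else - fwd_len e.2.

Definition jumps (e : darc) (c : 'I_n) : bool :=
  match e.2 with inl i => in_row i c | inr j => j == c end.

Definition is_row_arc (e : darc) : bool := if e.2 is inl _ then true else false.

(* A (simple directed) circuit, given as the cyclic sequence of its arcs:
   consecutive arcs are head-to-tail (cyclically) and no node is repeated. *)
Definition is_circuit (s : seq darc) : Prop :=
  [/\ s != [::], uniq (map arc_tail s)
    & cycle (fun e f => arc_head e == arc_tail f) s].

(* winding number: p(Gamma) * n = sum of lengths *)
Definition winding (s : seq darc) : int := ((\sum_(e <- s) arc_len e) %/ n%:Z)%Z.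

Definition row_weight (b : 'I_m -> int) (e : darc) : int :=
  match e with
  | (true, inl i) => b i
  | (false, inl i) => - b i
  | _ => 0
  end.

Definition tGamma (b : 'I_m -> int) (s : seq darc) : int :=
  \sum_(e <- s) row_weight b e.

Definition rev_row_sum (b : 'I_m -> int) (s : seq darc) : int :=
  \sum_(e <- s | ~~ e.1 && is_row_arc e) (- row_weight b e).

Definition pminus (s : seq darc) (c : 'I_n) : nat :=
  count (fun e => ~~ e.1 && jumps e c) s.

Definition no_reverse_row_arcs (s : seq darc) : bool :=
  all (fun e => e.1 || ~~ is_row_arc e) s.

(* The Gamma-inequality (for p(Gamma) <> 0) *)
Definition gamma_ineq {R : numDomainType} (b : 'I_m -> int) (s : seq darc)
    (x : 'cV[R]_n) : Prop :=
  let p := winding s in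
  let t := tGamma b s in
  let beta := (t %/ p)%Z in
  let r := (t %% p)%Z in
  (r * (beta + 1) + rev_row_sum b s)%:~R
    <= \sum_(c < n) (((pminus s c)%:Z + r)%:~R * x c 0).

End CircularDigraph.

Definition Qpoly {R : numDomainType} m n (A : 'M[R]_(m, n)) (b : 'I_m -> int)
    (x : 'cV[R]_n) : Prop :=
  (forall i, (b i)%:~R <= (A *m x) i 0) /\ (forall j, 0 <= x j 0).

Definition conv_hull {R : numDomainType} n (S : 'cV[R]_n -> Prop)
    (x : 'cV[R]_n) : Prop :=
  exists N (pts : 'I_N -> 'cV[R]_n) (w : 'I_N -> R),
    [/\ forall t, S (pts t), forall t, 0 <= w t, \sum_t w t = 1
      & x = \sum_t w t *: pts t].

Definition Qstar {R : archiNumDomainType} m n (A : 'M[R]_(m, n)) (b : 'I_m -> int)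
    (x : 'cV[R]_n) : Prop :=
  conv_hull (fun y => Qpoly A b y /\ forall j, y j 0 \is a Num.int) x.

(* Main.v *)
Require Import Defs.
From HB Require Import structures.
From mathcomp Require Import all_boot all_order all_algebra.
From mathcomp Require Import zify ring lra.
From mathcomp Require Import reals.
Import Order.TTheory GRing.Theory Num.Theory.
Local Open Scope ring_scope.
Set Implicit Arguments.
Unset Strict Implicit.
Unset Printing Implicit Defensive.

(** Written in the partial sums of [x], the constraints of [Q(A, b)] on the slice
    [1 x = beta] are integral difference constraints on the nodes of [D(A)], so
    rounding partial sums shows that integral slices of [Q(A, b)] are integral.
    If [1 x = beta + mu] with [0 < mu < 1], it remains to write
    [x = (1 - mu) y + mu z] with [y] and [z] in the slices [beta] and [beta + 1].
    This is again a system of difference constraints on [D(A)] (forward arcs bound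
    [y] from below, reverse arcs bound [z] from below), solvable unless some circuit
    [Gamma] has positive weight; the condition for [Gamma] is its
    [Gamma]-inequality with [beta] in place of [floor (t / p)], and it is trivial
    unless the two numbers agree and [p] does not divide [t].

    Circuits with reverse row arcs are discarded as follows. Relax the row
    constraints on [z] by the least [lam] that makes the system solvable. If
    [lam > 0], some circuit through a reverse row arc is tight for a solution.
    Along that circuit no forward row arc can follow a reverse one, since no row
    dominates another, so all its row arcs are reverse; comparing the total
    increments of [y] and [z] then gives a winding number both positive and
    negative. *)

Section Digraph.
Variables (V : eqType) (E : finType) (src dst : E -> V).

Definition meets : rel E := fun e f => dst e == src f.

Definition circuitb (s : seq E) : bool :=
  [&& s != [::], uniq (map src s) & cycle meets s].

Fixpoint walk (v : V) (s : seq E) : bool :=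
  if s is e :: s' then (src e == v) && walk (dst e) s' else true.

Definition simple_walk v s := walk v s && uniq (v :: map dst s).

Lemma walk_cat v s t :
  walk v (s ++ t) = walk v s && walk (last v (map dst s)) t.
Proof. by elim: s v => //= e s IH v; rewrite IH andbA. Qed.

Lemma path_meets e s : path meets e s = walk (dst e) s.
Proof. by elim: s e => //= f s IH e; rewrite IH /meets eq_sym. Qed.

Lemma cycle_meets e s : cycle meets (e :: s) =
  walk (dst e) s && (last (dst e) (map dst s) == src e).
Proof. by rewrite /= path_meets -cats1 walk_cat /= andbT [src e == _]eq_sym. Qed.

Lemma walk_src v s : walk v s ->
  rcons (map src s) (last v (map dst s)) = v :: map dst s.
Proof. by elim: s v => //= e s IH v /andP[/eqP-> /IH->]. Qed.

Lemma cycle_src_dst s : cycle meets s -> perm_eq (map src s) (map dst s).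
Proof.
case: s => // e s; rewrite cycle_meets => /andP[ws /eqP eqe].
have we : walk (src e) (e :: s) by rewrite /= eqxx.
have := walk_src we; rewrite [last _ _]eqe => h.
by rewrite -(perm_cons (src e)) -h perm_sym perm_rcons.
Qed.

Lemma simple_walk_size v s : simple_walk v s -> (size s <= #|E|)%N.
Proof.
case/andP=> ws us; rewrite -(card_uniqP _) ?max_card //.
move: us; rewrite -(walk_src ws) rcons_uniq => /andP[_].
exact: map_uniq.
Qed.

Lemma simple_walk_behead_cat v s t : simple_walk v (s ++ t) ->
  simple_walk (last v (map dst s)) t.
Proof.
rewrite /simple_walk walk_cat => /andP[/andP[_ ->]].
by rewrite map_cat -cat_cons lastI cat_rcons cat_uniq => /and3P[_ _ ->].
Qed.

End Digraph.

Section Potential.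
Variables (R : realDomainType) (V : eqType) (E : finType) (src dst : E -> V).
Variable w : E -> R.
Hypothesis circuit_le0 :
  forall s, circuitb src dst s -> \sum_(e <- s) w e <= 0.

(* The potential at [v] is minus the largest weight of a simple walk out of [v]. *)
Lemma potential_exists :
  exists pot : V -> R, forall e, w e <= pot (dst e) - pot (src e).
Proof.
pose P v (s : #|E|.-bseq E) := simple_walk src dst v s.
have P0 v : P v [bseq] by [].
pose best v := [arg max_(s > [bseq] | P v s) \sum_(e <- s) w e]%O.
have bestP v : P v (best v) /\
    forall s, simple_walk src dst v s ->
      \sum_(e <- s) w e <= \sum_(e <- best v) w e.
  rewrite /best; case: Order.TotalTheory.arg_maxP => // s Ps maxs.
  split=> // t Pt; have szt := simple_walk_size Pt.
  exact: (maxs (Bseq szt)).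
exists (fun v => - \sum_(e <- best v) w e) => e.
rewrite opprK addrC lerBrDr.
have [/[dup] Pv /andP[wv uv] _] := bestP (dst e).
have [_ maxu] := bestP (src e).
set s := bseqval (best (dst e)) in Pv wv uv *.
have we : walk src dst (src e) (e :: s) by rewrite /= eqxx.
have [srcin|srcout] := boolP (src e \in dst e :: map dst s); last first.
  rewrite -[_ + _](big_cons _ _ _ _ xpredT); apply: maxu.
  by rewrite /simple_walk we /= srcout.
have [s1 [s2 [es ls]]] : exists s1 s2, s = s1 ++ s2 /\
    last (dst e) (map dst s1) = src e.
  move: srcin; rewrite inE => /orP[/eqP h|].
    by exists [::], s.
  move=> /[dup] h; rewrite -index_mem => hi; set i := index _ _ in hi.
  exists (take i.+1 s), (drop i.+1 s); rewrite cat_take_drop; split=> //.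
  rewrite size_map in hi.
  by rewrite (take_nth e hi) map_rcons last_rcons -(nth_map _ (src e)) // nth_index.
have : simple_walk src dst (dst e) s by exact: Pv.
rewrite es => /simple_walk_behead_cat; rewrite ls => /maxu le2.
have ws1 : walk src dst (dst e) s1 by move: wv; rewrite es walk_cat => /andP[].
have ce : cycle (meets src dst) (e :: s1) by rewrite cycle_meets ws1 ls eqxx.
have /circuit_le0 : circuitb src dst (e :: s1).
  rewrite /circuitb ce andbT (perm_uniq (cycle_src_dst ce)).
  by move: uv; rewrite es map_cat -cat_cons cat_uniq => /and3P[].
rewrite big_cons big_cat /= addrA => le1.
by rewrite -[leRHS]add0r lerD.
Qed.

End Potential.

Section Quasiperiodic.
Variables (V : zmodType) (n : nat).
Implicit Types (G : nat -> V) (B : V).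

Definition quasiperiodic B G := forall t, G (t + n.+1)%N = G t + B.

Lemma quasiperiodicM B G q t : quasiperiodic B G ->
  G (t + q * n.+1)%N = G t + B *+ q.
Proof.
move=> per; elim: q => [|q IH]; first by rewrite mul0n addn0 mulr0n addr0.
by rewrite mulSn addnCA addnC per IH mulrSr addrA.
Qed.

Lemma quasiperiodic_mod B G t : quasiperiodic B G ->
  G t = G (t %% n.+1)%N + B *+ (t %/ n.+1).
Proof.
by move=> per; rewrite -quasiperiodicM // addnC -divn_eq.
Qed.

Lemma quasiperiodic_incr B G s t d : quasiperiodic B G ->
  s = t %[mod n.+1] -> G (s + d)%N - G s = G (t + d)%N - G t.
Proof.
move=> per est.
have H u : G (u + d)%N - G u = G (u %% n.+1 + d)%N - G (u %% n.+1)%N.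
  rewrite {1 2}(divn_eq u n.+1) -addnA ![(u %/ n.+1 * n.+1 + _)%N]addnC.
  by rewrite !(quasiperiodicM _ _ per) opprD addrACA subrr addr0.
by rewrite H est -H.
Qed.

Lemma quasiperiodic_shift B G a : quasiperiodic B G ->
  quasiperiodic B (fun t => G (t + a)%N).
Proof. by move=> per t; rewrite addnAC per. Qed.

Definition partial_sum (v : 'I_n.+1 -> V) (t : nat) : V :=
  \sum_(u < t) v (inZp u).

Lemma partial_sumS v t : partial_sum v t.+1 = partial_sum v t + v (inZp t).
Proof. by rewrite /partial_sum big_ord_recr. Qed.

Lemma partial_sum_quasiperiodic v :
  quasiperiodic (\sum_c v c) (partial_sum v).
Proof.
elim=> [|t IH].
  rewrite add0n /partial_sum big_ord0 add0r; apply: eq_bigr => c _.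
  by congr v; apply: val_inj; rewrite /= modn_small.
rewrite addSn !partial_sumS IH addrAC; congr (_ + v _ + _).
by apply: val_inj; rewrite /= modnDr.
Qed.

End Quasiperiodic.

Section Lifting.
Variables (m n : nat) (l : 'I_m -> 'I_n.+1) (k : 'I_m -> nat).
Hypothesis k_bounds : forall i, (2 <= k i <= n)%N.

Lemma row_sum_incr (V : zmodType) (B : V) (F : nat -> V) i :
  quasiperiodic n B F ->
  \sum_(c < n.+1 | in_row l k i c) (F c.+1 - F c) = F (l i + k i)%N - F (l i).
Proof.
move=> per; rewrite (reindex_inj (addrI (l i))) /=.
have /andP[_ kn] := k_bounds i.
have E d : in_row l k i (l i + d) = (d < k i)%N.
  have := ltn_ord (l i); have := ltn_ord d; rewrite /in_row /= => dn ln.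
  move: (nat_of_ord d) (nat_of_ord (l i)) dn ln => {}d a dn an.
  have [lt|ge] := ltnP (a + d) n.+1.
    by rewrite (modn_small lt) -addnA addKn modnDr (modn_small dn).
  have lt : (a + d - n.+1 < n.+1)%N by lia.
  have -> : ((a + d) %% n.+1 = a + d - n.+1)%N.
    by rewrite -[in LHS](subnK ge) modnDr (modn_small lt).
  by rewrite subnK // addKn (modn_small dn).
rewrite (eq_bigl _ _ E).
transitivity (\sum_(d < n.+1 | (d < k i)%N) (F (l i + d).+1%N - F (l i + d)%N)).
  apply: eq_bigr => d _ /=.
  have e : (l i + d) %% n.+1 = l i + d %[mod n.+1] by rewrite modn_mod.
  by have := quasiperiodic_incr 1 per e; rewrite !addn1.
rewrite -(big_ord_widen _ (fun d => F (l i + d).+1 - F (l i + d)%N)) 1?leqW //.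
rewrite -(big_mkord xpredT (fun d => F (l i + d).+1 - F (l i + d)%N)).
under eq_bigr do rewrite -addnS.
by rewrite (telescope_sumr (fun d => F (l i + d)%N)) // addn0.
Qed.

Lemma sum_incr (V : zmodType) (B : V) (F : nat -> V) :
  quasiperiodic n B F -> \sum_(c < n.+1) (F c.+1 - F c) = B.
Proof.
move=> per; rewrite -(big_mkord xpredT (fun c => F c.+1 - F c)).
by rewrite telescope_sumr // -[n.+1]add0n per addrC addKr.
Qed.

Definition start (a : 'I_m + 'I_n.+1) : nat :=
  match a with inl i => l i | inr j => j end.

Definition span (a : 'I_m + 'I_n.+1) : nat :=
  match a with inl i => k i | inr _ => 1%N end.

(* Forward arc [a] lifts to the arc [lift_tail a -> lift_tail a + span a] on the
   universal cover of the cycle of nodes; the shift by [n] keeps it in [nat]. *)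
Definition lift_tail a := (start a + n)%N.

Definition lift_head a := (lift_tail a + span a)%N.

Lemma fwd_tailE a : fwd_tail l a = (lift_tail a %% n.+1)%N.
Proof. by case: a => [i|j] /=; rewrite addnS. Qed.

Lemma fwd_headE a : fwd_head l k a = (lift_head a %% n.+1)%N.
Proof.
case: a => [i|j] /=; rewrite /lift_head /lift_tail /=.
  by rewrite addnS /= addnAC.
by rewrite addn1 -addnS modnDr.
Qed.

Definition wraps (e : darc m n.+1) : int :=
  let d := (lift_head e.2 %/ n.+1)%:Z - (lift_tail e.2 %/ n.+1)%:Z in
  if e.1 then d else - d.

Definition arc_incr (V : zmodType) (G : nat -> V) (e : darc m n.+1) : V :=
  let d := G (lift_head e.2) - G (lift_tail e.2) in if e.1 then d else - d.

Lemma arc_incrE (V : zmodType) (B : V) G e : quasiperiodic n B G ->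
  arc_incr G e = G (arc_head l k e) - G (arc_tail l k e) + B *~ wraps e.
Proof.
move=> per; case: e => b a; rewrite /arc_incr /arc_head /arc_tail /wraps /=.
rewrite fwd_tailE fwd_headE.
rewrite (quasiperiodic_mod (lift_head a) per) (quasiperiodic_mod (lift_tail a) per).
have E : G (lift_head a %% n.+1)%N + B *+ (lift_head a %/ n.+1) -
  (G (lift_tail a %% n.+1)%N + B *+ (lift_tail a %/ n.+1)) =
  G (lift_head a %% n.+1)%N - G (lift_tail a %% n.+1)%N +
  B *~ ((lift_head a %/ n.+1)%:Z - (lift_tail a %/ n.+1)%:Z).
  by rewrite mulrzBr -!pmulrn opprD addrACA.
by case: b; rewrite E // opprD opprB mulrNz.
Qed.

Lemma is_circuitP s :
  is_circuit l k s <-> circuitb (arc_tail l k) (arc_head l k) s.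
Proof. by split=> [[? ? ?]|/and3P[]]; [apply/and3P|]. Qed.

Lemma sum_arc_incr (V : zmodType) (B : V) G s : quasiperiodic n B G ->
  is_circuit l k s -> \sum_(e <- s) arc_incr G e = B *~ (\sum_(e <- s) wraps e).
Proof.
move=> per /is_circuitP/and3P[_ _ /cycle_src_dst cyc].
under eq_bigr do rewrite (arc_incrE _ per).
rewrite big_split /= sumrB -(big_map (arc_head l k) xpredT G).
rewrite -(big_map (arc_tail l k) xpredT G) (perm_big _ cyc) subrr add0r.
by rewrite mulrz_sumr.
Qed.

Lemma windingE s : is_circuit l k s -> winding k s = \sum_(e <- s) wraps e.
Proof.
move=> cs; have per : quasiperiodic n n.+1%:Z Posz by move=> t; rewrite PoszD.
rewrite /winding.
have -> : \sum_(e <- s) arc_len k e = \sum_(e <- s) arc_incr Posz e.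
  apply: eq_bigr => -[b a] _; rewrite /arc_len /arc_incr /=.
  have -> : fwd_len k a = Posz (lift_head a) - Posz (lift_tail a).
    by case: a => [i|j]; rewrite /lift_head PoszD addrC addKr.
  by [].
by rewrite (sum_arc_incr per cs) -mulrzr intz mulrC mulzK.
Qed.

Lemma sum_arc_incr_winding (V : zmodType) (B : V) G s : quasiperiodic n B G ->
  is_circuit l k s -> \sum_(e <- s) arc_incr G e = B *~ winding k s.
Proof. by move=> per cs; rewrite windingE // (sum_arc_incr per cs). Qed.

End Lifting.

Section ConvexHull.
Variables (R : numDomainType) (n : nat) (S : 'cV[R]_n -> Prop).

Lemma conv_hull_convex x y a b : conv_hull S x -> conv_hull S y ->
  0 <= a -> 0 <= b -> a + b = 1 -> conv_hull S (a *: x + b *: y).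
Proof.
move=> [N [p [u [Sp u0 u1 ->]]]] [M [q [v [Sq v0 v1 ->]]]] a0 b0 ab.
pose join T (f : 'I_N -> T) (g : 'I_M -> T) (t : 'I_(N + M)) :=
  match split t with inl i => f i | inr j => g j end.
have joinl T f g i : join T f g (lshift M i) = f i.
  by rewrite /join (unsplitK (inl i)).
have joinr T f g j : join T f g (rshift N j) = g j.
  by rewrite /join (unsplitK (inr j)).
exists (N + M)%N, (join _ p q), (join _ (fun i => a * u i) (fun j => b * v j)).
split.
- by move=> t; rewrite /join; case: split.
- by move=> t; rewrite /join; case: split => i; rewrite mulr_ge0.
- rewrite big_split_ord /=; under eq_bigr do rewrite joinl.
  under [X in _ + X]eq_bigr do rewrite joinr.
  by rewrite -!mulr_sumr u1 v1 !mulr1.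
- rewrite big_split_ord /=; under [X in _ = X + _]eq_bigr do rewrite !joinl -scalerA.
  under [X in _ = _ + X]eq_bigr do rewrite !joinr -scalerA.
  by rewrite -!scaler_sumr.
Qed.

Lemma conv_hull_ge (a : 'I_n -> R) d x :
  (forall y, S y -> d <= \sum_c a c * y c 0) ->
  conv_hull S x -> d <= \sum_c a c * x c 0.
Proof.
move=> dS [N [p [u [Sp u0 u1 ->]]]].
have -> : \sum_c a c * (\sum_t u t *: p t) c 0 =
    \sum_t u t * \sum_c a c * p t c 0.
  under eq_bigr do rewrite summxE mulr_sumr.
  rewrite exchange_big; apply: eq_bigr => t _; rewrite mulr_sumr.
  by apply: eq_bigr => c _; rewrite mxE mulrCA.
rewrite -[d]mul1r -u1 mulr_suml; apply: ler_sum => t _.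
by rewrite ler_wpM2l // dS.
Qed.

End ConvexHull.

Lemma layer_cake (R : realDomainType) (s : seq R) :
  (forall f, f \in s -> 0 <= f <= 1) ->
  exists N (g w : 'I_N -> R),
    [/\ forall t, 0 <= w t, forall t, 0 <= g t <= 1, \sum_t w t = 1
      & forall f, f \in s -> \sum_t w t * (g t <= f)%R%:R = f].
Proof.
move=> s01; pose S := sort <=%R (0 :: 1 :: s).
have szS : size S = (size s).+2 by rewrite size_sort.
have memS f : (f \in S) = (f \in [:: 0, 1 & s]) by rewrite mem_sort.
have S01 f : f \in S -> 0 <= f <= 1.
  by rewrite memS !inE => /or3P[/eqP->|/eqP->|/s01 //]; rewrite !lexx ?ler01.
have leS i j : (i <= j)%N -> (j < (size s).+2)%N -> S`_i <= S`_j.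
  move=> ij jS; apply: sorted_leq_nth => //; rewrite ?inE ?szS //.
  - exact: le_trans.
  - exact: sort_le_sorted.
  - exact: leq_ltn_trans jS.
pose N := (size s).+1.
have key f : f \in S ->
    \sum_(t < N) (S`_t.+1 - S`_t) * (S`_t.+1 <= f)%R%:R = f.
  move=> fS; have := fS; rewrite -index_mem szS; set j := index f S => jS.
  have fE : f = S`_j by rewrite nth_index.
  transitivity (\sum_(t < N) (Num.min S`_t.+1 f - Num.min S`_t f)).
    apply: eq_bigr => t _; rewrite fE; have [tj|jt] := ltnP t j.
      rewrite leS // mulr1 !min_l // ?leS //; exact: ltnW.
    have tN : (t.+1 < (size s).+2)%N by rewrite ltnS ltn_ord.
    have jt1 : S`_j <= S`_t by rewrite leS // ltnW.
    have jt2 : S`_t <= S`_t.+1 by rewrite leS.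
    have jt3 := le_trans jt1 jt2.
    rewrite !(min_r jt1) !(min_r jt3) subrr.
    have [le|] := leP S`_t.+1 S`_j; last by rewrite mulr0.
    have -> : S`_t.+1 = S`_t by apply/eqP; rewrite eq_le jt2 (le_trans le).
    by rewrite subrr mul0r.
  rewrite -(big_mkord xpredT (fun t => Num.min S`_t.+1 f - Num.min S`_t f)).
  rewrite (telescope_sumr (fun t => Num.min S`_t f)) // fE.
  have S0 : S`_0 = 0.
    apply/eqP; rewrite eq_le; apply/andP; split.
      have z : 0 \in S by rewrite memS inE eqxx.
      have e : S`_(index 0 S) = 0 by exact: nth_index.
      apply: le_trans (_ : S`_(index 0 S) <= 0); last by rewrite e.
      by apply: leS => //; rewrite -szS index_mem.
    by have /S01/andP[] : S`_0 \in S by rewrite mem_nth // szS.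
  have j0 : 0 <= S`_j by rewrite -fE; have /andP[] := S01 _ fS.
  by rewrite S0 (min_l j0) subr0 min_r // leS.
exists N, (fun t => S`_t.+1), (fun t => S`_t.+1 - S`_t); split.
- by move=> t; rewrite subr_ge0 leS // ltnS ltn_ord.
- by move=> t; apply: S01; rewrite mem_nth // szS ltnS ltn_ord.
- rewrite -[RHS](key 1) ?memS ?inE ?eqxx ?orbT //; apply: eq_bigr => t _.
  have /andP[_ ->] : 0 <= S`_t.+1 <= 1.
    by apply: S01; rewrite mem_nth // szS ltnS ltn_ord.
  by rewrite mulr1.
- by move=> f fs; apply: key; rewrite memS !inE fs !orbT.
Qed.

Lemma circular_mulmx (R : nzRingType) (m n : nat) (l : 'I_m -> 'I_n)
    (k : 'I_m -> nat) (A : 'M[R]_(m, n)) (y : 'cV[R]_n) i :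
  circular_data l k A -> (A *m y) i 0 = \sum_(c | in_row l k i c) y c 0.
Proof.
move=> [_ Aval]; rewrite mxE [RHS]big_mkcond; apply: eq_bigr => c _.
by rewrite Aval; case: ifP; rewrite ?mul1r ?mul0r.
Qed.

(* Rounding the partial sums [eta t] of [y] to [floor (eta t + 1 - g)] keeps every
   integral difference constraint, and averaging over [g] gives back [eta]. *)
Lemma integral_slice (R : archiRealFieldType) (m n : nat) (l : 'I_m -> 'I_n.+1)
    (k : 'I_m -> nat) (A : 'M[R]_(m, n.+1)) (b : 'I_m -> int) (y : 'cV[R]_n.+1)
    (beta : int) :
  circular_data l k A -> Qpoly A b y -> \sum_c y c 0 = beta%:~R -> Qstar A b y.
Proof.
move=> cA [Ay y0] sumy; have kb := cA.1.
pose v c := y c 0; pose eta := partial_sum v.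
have eta_per : quasiperiodic n beta%:~R eta.
  by rewrite -sumy; exact: partial_sum_quasiperiodic.
have etaS (c : 'I_n.+1) : eta c.+1 - eta c = y c 0.
  rewrite /eta partial_sumS addrC addKr; congr (y _ 0).
  by apply: val_inj; rewrite /= modn_small.
pose fr t := eta t - (Num.floor (eta t))%:~R.
have fr01 t : 0 <= fr t < 1.
  have /andP[h1 h2] := floor_itv (eta t).
  by rewrite intrD in h2; rewrite /fr subr_ge0 h1 ltrBlDr addrC.
have [|N [g [w [w0 g01 w1 wf]]]] := @layer_cake R [seq fr t | t <- iota 0 n.+2].
  by move=> f /mapP[t _ ->]; have /andP[-> /ltW] := fr01 t.
pose F t u := Num.floor (eta u + (1 - g t)).
have F_per t : quasiperiodic n beta (F t).
  move=> u; rewrite /F eta_per addrAC floorDrz ?intr_int //.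
  by rewrite intrKfloor.
have Favg u : (u <= n.+1)%N -> \sum_t w t * (F t u)%:~R = eta u.
  move=> un; have := wf (fr u).
  rewrite map_f ?mem_iota // => /(_ isT) h.
  have FE t : (F t u)%:~R = (Num.floor (eta u))%:~R + (g t <= fr u)%R%:R :> R.
    have /andP[g0 g1] := g01 t; have /andP[f0 f1] := fr01 u.
    have e : eta u = (Num.floor (eta u))%:~R + fr u by rewrite /fr addrC subrK.
    rewrite pmulrn -intrD; congr (_%:~R); apply: floor_def.
    rewrite !intrD; case: (leP (g t) (fr u)) => /= hg; lra.
  under eq_bigr do rewrite FE mulrDr.
  by rewrite big_split /= h -mulr_suml w1 mul1r /fr addrC subrK.
have F_le t u u' (d : int) : eta u + d%:~R <= eta u' -> F t u + d <= F t u'.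
  move=> le; rewrite /F -[X in _ + X](@intrKfloor R) -floorDrz ?intr_int //.
  by rewrite le_floor // addrAC lerD2r.
exists N, (fun t => \col_c (F t c.+1 - F t c)%:~R), w; split => //.
- move=> t; split; last by move=> c; rewrite mxE intr_int.
  split=> [i|c]; last first.
    by rewrite mxE ler0z subr_ge0 -[leLHS]addr0 F_le // addr0 -subr_ge0 etaS.
  rewrite (circular_mulmx _ _ cA).
  under eq_bigr do rewrite mxE.
  rewrite -(rmorph_sum (intr : int -> R)) ler_int (row_sum_incr l kb _ (F_per t)).
  rewrite lerBrDl F_le // -lerBrDl.
  have := Ay i; rewrite (circular_mulmx _ _ cA).
  by under eq_bigr do rewrite -etaS; rewrite (row_sum_incr l kb _ eta_per).
- apply/colP => c; rewrite summxE.
  under eq_bigr do rewrite !mxE intrB mulrBr.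
  by rewrite sumrB !Favg ?etaS // ltnW.
Qed.

Lemma circuitb_size (V : eqType) (E : finType) (src dst : E -> V) s :
  circuitb src dst s -> (size s <= #|E|)%N.
Proof.
by case/and3P=> _ /map_uniq us _; rewrite -(card_uniqP us) max_card.
Qed.

Section Intervals.
Variables (m n : nat) (l : 'I_m -> 'I_n.+1) (k : 'I_m -> nat).
Hypothesis k_bounds : forall i, (2 <= k i <= n)%N.

Lemma row_incr (V : zmodType) (B : V) (G : nat -> V) i : quasiperiodic n B G ->
  G (lift_head l k (inl i)) - G (lift_tail l (inl i)) =
  \sum_(c | in_row l k i c) (G (lift_head l k (inr c)) - G (lift_tail l (inr c))).
Proof.
move=> per; have := row_sum_incr l k_bounds i (quasiperiodic_shift n per).
rewrite /lift_head /lift_tail /= addnAC => <-.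
by apply: eq_bigr => c _; rewrite addn1.
Qed.

Definition vec_sum (V : zmodType) (x : 'I_n.+1 -> V) (a : 'I_m + 'I_n.+1) : V :=
  match a with inl i => \sum_(c | in_row l k i c) x c | inr j => x j end.

Definition cumul (V : zmodType) (x : 'I_n.+1 -> V) t := partial_sum x t.+1.

Lemma cumul_quasiperiodic (V : zmodType) (x : 'I_n.+1 -> V) :
  quasiperiodic n (\sum_c x c) (cumul x).
Proof.
by move=> t; rewrite /cumul -addSn (partial_sum_quasiperiodic x).
Qed.

Lemma cumul_incr (V : zmodType) (x : 'I_n.+1 -> V) a :
  cumul x (lift_head l k a) - cumul x (lift_tail l a) = vec_sum x a.
Proof.
have Hj j : cumul x (lift_head l k (inr j)) - cumul x (lift_tail l (inr j)) = x j.
  rewrite /cumul /lift_head /= addn1 partial_sumS addrC addKr.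
  congr x; apply: val_inj => /=.
  by rewrite /lift_tail /= -addnS modnDr modn_small.
case: a => [i|j]; last exact: Hj.
rewrite (row_incr i (cumul_quasiperiodic x)).
by apply: eq_bigr => c _; rewrite Hj.
Qed.

Lemma nondecreasing_lift (R : numDomainType) (B : R) (G : nat -> R) :
  quasiperiodic n B G ->
  (forall j, 0 <= G (lift_head l k (inr j)) - G (lift_tail l (inr j))) ->
  {homo G : s t / (s <= t)%N >-> s <= t}.
Proof.
move=> per G0; apply: homo_leq => [//|y x z|t]; first exact: le_trans.
pose j : 'I_n.+1 := inZp t.+1.
have e : t = lift_tail l (inr j) %[mod n.+1].
  by rewrite /lift_tail /= modnDml addSnnS modnDr.
rewrite -subr_ge0 -addn1 (quasiperiodic_incr 1 per e); exact: (G0 j).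
Qed.

Hypothesis nodom :
  forall i j, i != j -> ~ (forall c, in_row l k i c -> in_row l k j c).

Lemma lifted_rows_ordered i j s t :
  s = lift_tail l (inl j) %[mod n.+1] -> t = lift_tail l (inl i) %[mod n.+1] ->
  (s <= t)%N -> (s + k j <= t + k i)%N.
Proof.
move=> es et st; rewrite leqNgt; apply/negP => lt.
have [eij|neij] := eqVneq i j; first by move: lt; rewrite eij; lia.
apply: (nodom neij) => c; rewrite /in_row.
have := ltn_ord c; have := ltn_ord (l i); have := ltn_ord (l j).
have /andP[_ kjn] := k_bounds j.
rewrite /lift_tail /= in es et.
move: (nat_of_ord (l i)) (nat_of_ord (l j)) (nat_of_ord c) es et => a b {}c es et.
move=> bn an cn; set u := ((c + n.+1 - a) %% n.+1)%N => uk.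
have ub : (u + (t - s) < n.+1)%N by lia.
suff -> : ((c + n.+1 - b) %% n.+1 = u + (t - s))%N by lia.
rewrite -(modn_small ub); apply/eqP; rewrite -(eqn_modDr (b + n)) addnA.
rewrite subnK ?(leq_trans (ltnW bn)) ?leq_addl //; apply/eqP.
transitivity ((u + (a + n)) %% n.+1)%N.
  by rewrite /u modnDml addnA subnK // (leq_trans (ltnW an)) ?leq_addl.
rewrite -modnDmr -et modnDmr -[RHS]modnDmr -es modnDmr; congr (_ %% _)%N; lia.
Qed.

End Intervals.

Section Slicing.
Variables (R : realFieldType) (m n : nat) (l : 'I_m -> 'I_n.+1) (k : 'I_m -> nat).
Hypothesis k_bounds : forall i, (2 <= k i <= n)%N.
Hypothesis nodom :
  forall i j, i != j -> ~ (forall c, in_row l k i c -> in_row l k j c).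
Variables (x : 'I_n.+1 -> R) (alpha beta mu : R).
Hypothesis x_ge0 : forall c, 0 <= x c.
Hypothesis row_ge : forall i, alpha <= vec_sum l k x (inl i).
Hypothesis alpha_ge0 : 0 <= alpha.
Hypothesis beta_ge0 : 0 <= beta.
Hypothesis mu01 : 0 < mu < 1.
Hypothesis sum_x : \sum_c x c = beta + mu.

Let B := (1 - mu) * beta.
Let tl := lift_tail (m := m) l.
Let hd := lift_head l k.

(* [H] and [cumul x - H] are the cumulated sums of the two summands of [x]; the
   lower bounds required from the second one on rows are relaxed by [lam]. *)
Definition slice_weight (lam : R) (e : darc m n.+1) : R :=
  match e with
  | (true, inl _) => (1 - mu) * alpha
  | (true, inr _) => 0
  | (false, inl i) => mu * alpha - lam - vec_sum l k x (inl i)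
  | (false, inr j) => - x j
  end.

Lemma slice_potential lam :
  (forall s, is_circuit l k s ->
     \sum_(e <- s) slice_weight lam e <= B *~ winding k s) ->
  exists2 H, quasiperiodic n B H
    & forall e, slice_weight lam e <= arc_incr l k H e.
Proof.
move=> hs; pose w e := slice_weight lam e - B *~ wraps l k e.
have [s /is_circuitP cs|pot potP] :=
    @potential_exists R nat _ (arc_tail l k) (arc_head l k) w.
  by rewrite sumrB -mulrz_sumr -(windingE cs) subr_le0 hs.
pose H t := pot (t %% n.+1)%N + B *+ (t %/ n.+1).
have perH : quasiperiodic n B H.
  by move=> t; rewrite /H modnDr divnDr // divnn /= addn1 mulrSr addrA.
exists H => // e; rewrite (arc_incrE l k e perH) -lerBlDr.
have Hmod t : H (t %% n.+1)%N = pot (t %% n.+1)%N.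
  by rewrite /H modn_mod divn_small ?ltn_mod // addr0.
have -> : H (arc_head l k e) = pot (arc_head l k e).
  by case: e => -[] a; rewrite /arc_head /= ?fwd_headE ?fwd_tailE.
have -> : H (arc_tail l k e) = pot (arc_tail l k e).
  by case: e => -[] a; rewrite /arc_tail /= ?fwd_headE ?fwd_tailE.
exact: potP.
Qed.

Section Tight.
Variables (lam : R) (H : nat -> R).
Hypothesis lam_gt0 : 0 < lam.
Hypothesis H_per : quasiperiodic n B H.
Hypothesis H_ge : forall e, slice_weight lam e <= arc_incr l k H e.

Let K t := cumul x t - H t.
Let tight e := arc_incr l k H e = slice_weight lam e.

Lemma K_quasiperiodic : quasiperiodic n (mu * (beta + 1)) K.
Proof.
move=> t; rewrite /K (cumul_quasiperiodic x) H_per sum_x /B; ring.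
Qed.

Lemma K_incr a : K (hd a) - K (tl a) = vec_sum l k x a - (H (hd a) - H (tl a)).
Proof. rewrite /K /hd /tl -(cumul_incr l k_bounds); ring. Qed.

Lemma H_homo : {homo H : s t / (s <= t)%N >-> s <= t}.
Proof.
apply: (@nondecreasing_lift m n l k _ _ _ H_per) => j.
exact: (H_ge (true, inr j)).
Qed.

Lemma K_homo : {homo K : s t / (s <= t)%N >-> s <= t}.
Proof.
apply: (@nondecreasing_lift m n l k _ _ _ K_quasiperiodic) => j.
have := H_ge (false, inr j); rewrite /arc_incr /= lerN2.
by have := K_incr (inr j); rewrite /hd /tl => -> ?; rewrite subr_ge0.
Qed.

Definition relaxed_row i :=
  (1 - mu) * alpha < H (hd (inl i)) - H (tl (inl i)) /\
  K (hd (inl i)) - K (tl (inl i)) < mu * alpha.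

Lemma tight_reverse_row i : tight (false, inl i) -> relaxed_row i.
Proof.
rewrite /tight /arc_incr /relaxed_row K_incr /= -/(hd _) -/(tl _).
have := row_ge i => /=; move: (\sum_(c | _) _) (H (hd _)) (H (tl _)) => v a b.
by move: lam_gt0 => *; split; lra.
Qed.

Definition below_relaxed_row (v : nat) := exists i s t,
  [/\ relaxed_row i, (s %% n.+1)%N = v, t = tl (inl i) %[mod n.+1],
      H s <= H t & K t <= K s].

Lemma not_below_forward_row j : tight (true, inl j) ->
  below_relaxed_row (arc_tail l k (true, inl j)) -> False.
Proof.
rewrite /tight /arc_incr /= -/(hd _) -/(tl _) => tj.
rewrite /arc_tail /= addnS /= => -[i [s [t [[Hi Ki] es et Hst Kst]]]].
have {}es : s = tl (inl j) %[mod n.+1] by [].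
have Kj : mu * alpha <= K (hd (inl j)) - K (tl (inl j)).
  by rewrite K_incr tj; have := row_ge j; lra.
have per := K_quasiperiodic.
rewrite /hd /lift_head in tj Kj Hi Ki.
rewrite -(quasiperiodic_incr _ H_per es) in tj.
rewrite -(quasiperiodic_incr _ per es) in Kj.
rewrite -(quasiperiodic_incr _ H_per et) in Hi.
rewrite -(quasiperiodic_incr _ per et) in Ki.
rewrite /= in tj Kj Hi Ki.
have [st|/ltnW ts] := leqP s t.
  have := K_homo (lifted_rows_ordered k_bounds nodom es et st); have := K_homo st.
  by move: (K _) (K _) (K _) (K _) Kj Ki Kst {es et st} => *; lra.
have := H_homo (lifted_rows_ordered k_bounds nodom et es ts); have := H_homo ts.
by move: (H _) (H _) (H _) (H _) tj Hi Hst {es et ts} => *; lra.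
Qed.

Lemma below_relaxed_row_step e : tight e ->
  below_relaxed_row (arc_tail l k e) -> below_relaxed_row (arc_head l k e).
Proof.
case: e => -[] [i|j] te.
- by move/(not_below_forward_row te).
- move=> [i [s [t [ri es et Hst Kst]]]]; exists i, s.+1, t.
  have {}es : s = tl (inr j) %[mod n.+1] by rewrite es /arc_tail fwd_tailE.
  have eH := quasiperiodic_incr 1 H_per es.
  have HE : H s.+1 = H s.
    move: te; rewrite /tight /arc_incr /= /hd /lift_head /= -eH addn1.
    by move/eqP; rewrite subr_eq0 => /eqP.
  split => //.
  + by rewrite /arc_head fwd_headE /lift_head /= -addn1 -modnDml es modnDml.
  + by rewrite HE.
  + by apply: le_trans Kst _; exact: K_homo.
- move=> _; exists i, (tl (inl i)), (tl (inl i)).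
  by split=> //; [exact: tight_reverse_row|rewrite /arc_head fwd_tailE].
- move=> [i [s [t [ri es et Hst Kst]]]]; exists i, (s + n)%N, (t + n.+1)%N.
  have {}es : (s + n)%N = tl (inr j) %[mod n.+1].
    rewrite -modnDml es /arc_tail fwd_headE /= modnDml /lift_head /=.
    by rewrite addn1 addSnnS modnDr.
  have eK := quasiperiodic_incr 1 K_quasiperiodic es.
  have KE : K (s + n.+1)%N = K (s + n)%N.
    rewrite addn1 -addnS in eK; apply/eqP; rewrite -subr_eq0 eK.
    have := K_incr (inr j); rewrite /hd /lift_head => -> /=.
    move: te; rewrite /tight /arc_incr /= => /oppr_inj.
    by rewrite /lift_head /= => ->; rewrite subrr.
  split => //.
  + by rewrite /arc_head fwd_tailE es.
  + by rewrite modnDr.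
  + rewrite H_per; apply: le_trans (_ : H s + B <= _); last by rewrite lerD2r.
    by rewrite -H_per H_homo // leq_add2l.
  + by rewrite -KE !K_quasiperiodic lerD2r.
Qed.

Lemma walk_below_relaxed_row v s : below_relaxed_row v ->
  walk (arc_tail l k) (arc_head l k) v s -> (forall e, e \in s -> tight e) ->
  all (fun e => ~~ (e.1 && is_row_arc e)) s.
Proof.
elim: s v => //= e s IH v bv /andP[/eqP ev we] ts; rewrite -ev in bv.
have te : tight e by apply: ts; rewrite inE eqxx.
rewrite (IH (arc_head l k e)) ?andbT //.
- case: e te bv {we ts ev IH} => -[] [i|j] //= te /(not_below_forward_row te) //.
- exact: below_relaxed_row_step.
- by move=> f fs; apply: ts; rewrite inE fs orbT.
Qed.

Lemma arc_incr_K e : arc_incr l k K e = arc_incr l k (cumul x) e - arc_incr l k H e.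
Proof. by case: e => -[] a; rewrite /arc_incr /= /K; ring. Qed.

Lemma tight_reverse_row_lt i : tight (false, inl i) ->
  arc_incr l k H (false, inl i) < 0 /\
  mu * arc_incr l k H (false, inl i) < (1 - mu) * arc_incr l k K (false, inl i).
Proof.
have /andP[mu0 mu1] := mu01; move=> /tight_reverse_row[].
rewrite /arc_incr /= -/(hd _) -/(tl _).
move: (H (hd _) - _) (K (hd _) - _) => h q hh hq.
have nu0 : 0 < 1 - mu by rewrite subr_gt0.
split.
  by rewrite oppr_lt0; apply: le_lt_trans hh; rewrite mulr_ge0 // ltW.
rewrite !mulrN ltrN2 (@lt_trans _ _ ((1 - mu) * (mu * alpha))) ?ltr_pM2l //.
by rewrite mulrCA ltr_pM2l.
Qed.

Lemma tight_non_forward e : tight e -> ~~ (e.1 && is_row_arc e) ->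
  arc_incr l k H e <= 0 /\
  mu * arc_incr l k H e <= (1 - mu) * arc_incr l k K e.
Proof.
have /andP[mu0 mu1] := mu01.
case: e => -[] [i|j] // te _.
- rewrite te /=; split=> //; rewrite mulr0; apply: mulr_ge0.
    by rewrite subr_ge0 ltW.
  by rewrite /arc_incr /= subr_ge0; apply: K_homo; apply: leq_addr.
- by have [/ltW ? /ltW ?] := tight_reverse_row_lt te.
- rewrite arc_incr_K te /arc_incr (cumul_incr l k_bounds) /= subrr mulr0.
  by rewrite mulrN !oppr_le0 mulr_ge0 // ltW.
Qed.

Lemma no_tight_reverse_row_circuit i s :
  is_circuit l k ((false, inl i) :: s) ->
  (forall e, e \in (false, inl i) :: s -> tight e) -> False.
Proof.
set e0 : darc m n.+1 := (false, inl i) => cs ts.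
have /andP[mu0 mu1] := mu01.
have te0 : tight e0 by apply: ts; rewrite inE eqxx.
have ts' e : e \in s -> tight e by move=> es; apply: ts; rewrite inE es orbT.
have /is_circuitP/and3P[_ _] := cs; rewrite cycle_meets => /andP[ws _].
have b0 : below_relaxed_row (arc_head l k e0).
  exists i, (tl (inl i)), (tl (inl i)).
  by split=> //; [exact: tight_reverse_row|rewrite /arc_head fwd_tailE].
have /allP fs := walk_below_relaxed_row b0 ws ts'.
have [h1 h2] := tight_reverse_row_lt te0.
have sumH := sum_arc_incr_winding H_per cs.
have sumK := sum_arc_incr_winding K_quasiperiodic cs.
have H_lt0 : \sum_(e <- e0 :: s) arc_incr l k H e < 0.
  rewrite big_cons -[ltRHS]addr0 ltr_leD // big_seq sumr_le0 // => e es.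
  by have [] := tight_non_forward (ts' e es) (fs e es).
have HK : mu * \sum_(e <- e0 :: s) arc_incr l k H e <
    (1 - mu) * \sum_(e <- e0 :: s) arc_incr l k K e.
  rewrite !big_cons !mulrDr ltr_leD // !mulr_sumr big_seq [leRHS]big_seq.
  apply: ler_sum => e es.
  by have [] := tight_non_forward (ts' e es) (fs e es).
move: H_lt0 HK; rewrite sumH sumK -(mulrzr B) -(mulrzr (mu * _)) /B.
set p := (winding k _)%:~R => Hp HKp.
have nu0 : 0 < 1 - mu by rewrite subr_gt0.
have p_gt0 : 0 < p.
  have : 0 < (mu * (1 - mu)) * p by lra.
  by rewrite pmulr_rgt0 // mulr_gt0.
have : 0 <= (1 - mu) * beta * p by rewrite !mulr_ge0 // ltW.
by rewrite leNgt Hp.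
Qed.

End Tight.

Definition nb_reverse_rows (s : seq (darc m n.+1)) : nat :=
  count (fun e => ~~ e.1 && is_row_arc e) s.

Lemma slice_weight_relax lam s :
  \sum_(e <- s) slice_weight lam e =
  \sum_(e <- s) slice_weight 0 e - lam * (nb_reverse_rows s)%:R.
Proof.
elim: s => [|e s IH]; first by rewrite !big_nil mulr0 subr0.
rewrite !big_cons IH /nb_reverse_rows /= natrD.
by case: e => -[] [i|j] /=; ring.
Qed.

Lemma is_circuit_rot q s : is_circuit l k s -> is_circuit l k (rot q s).
Proof.
case=> s0 us cs; split; first by rewrite -size_eq0 size_rot size_eq0.
- by rewrite map_rot rot_uniq.
- by rewrite rot_cycle.
Qed.

(* If some circuit were too heavy, relaxing the reverse row arcs by the least
   amount [lam] that restores feasibility would make a circuit with a reverse row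
   arc tight. *)
Lemma reverse_row_circuits_redundant :
  (forall s, is_circuit l k s -> nb_reverse_rows s = 0%N ->
     \sum_(e <- s) slice_weight 0 e <= B *~ winding k s) ->
  forall s, is_circuit l k s ->
     \sum_(e <- s) slice_weight 0 e <= B *~ winding k s.
Proof.
move=> hyp s0 cs0; rewrite leNgt; apply/negP => bad.
pose excess s := \sum_(e <- s) slice_weight 0 e - B *~ winding k s.
pose ratio s := excess s / (nb_reverse_rows s)%:R.
pose P (s : #|{: darc m n.+1}|.-bseq (darc m n.+1)) :=
  circuitb (arc_tail l k) (arc_head l k) s && (0 < nb_reverse_rows s)%N.
have rev0 : (0 < nb_reverse_rows s0)%N.
  by rewrite lt0n; apply/eqP => /(hyp _ cs0); rewrite leNgt bad.
have cb0 : circuitb (arc_tail l k) (arc_head l k) s0 by apply/is_circuitP.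
pose b0 := Bseq (circuitb_size cb0).
have Pb0 : P b0 by rewrite /P /= cb0.
case: (Order.TotalTheory.arg_maxP (fun s : _.-bseq _ => ratio s) Pb0).
move=> s /andP[cb rs] maxs; set lam := ratio s in maxs.
have cs : is_circuit l k s by apply/is_circuitP.
have excess0 : 0 < excess s0 by rewrite subr_gt0.
have lam_gt0 : 0 < lam.
  apply: lt_le_trans (maxs b0 Pb0).
  by rewrite divr_gt0 // ltr0n.
have [s' cs'|H perH H_ge] := @slice_potential lam.
  rewrite slice_weight_relax lerBlDl -lerBlDr.
  have [r0|r0] := posnP (nb_reverse_rows s').
    by rewrite r0 mulr0 subr_le0 hyp.
  have cb' : circuitb (arc_tail l k) (arc_head l k) s' by apply/is_circuitP.
  have := maxs (Bseq (circuitb_size cb')).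
  rewrite /P /= cb' r0 => /(_ isT).
  by rewrite /ratio ler_pdivrMr ?ltr0n.
have tight e : e \in (s : seq _) -> arc_incr l k H e = slice_weight lam e.
  have : \sum_(e <- s) (arc_incr l k H e - slice_weight lam e) == 0.
    rewrite sumrB (sum_arc_incr_winding perH cs) slice_weight_relax.
    rewrite /lam /ratio divfK ?pnatr_eq0 -?lt0n //.
    by rewrite /excess subKr subrr.
  rewrite psumr_eq0 => [/allP h es|f _]; last by rewrite subr_ge0.
  by have := h e es; rewrite /= subr_eq0 => /eqP.
have /hasP[e es] : has (fun e => ~~ e.1 && is_row_arc e) s by rewrite has_count.
case: e es => -[] [i|j] //= es _.
have [q s' rotE] := rot_to es.
apply: (@no_tight_reverse_row_circuit lam H lam_gt0 perH H_ge i s').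
  by rewrite -rotE; exact: is_circuit_rot.
by move=> e; rewrite -rotE mem_rot => /tight.
Qed.

End Slicing.

Section GammaInequalities.
Variables (R : realFieldType) (m n : nat) (l : 'I_m -> 'I_n.+1) (k : 'I_m -> nat).
Hypothesis k_bounds : forall i, (2 <= k i <= n)%N.
Variable alpha : nat.
Implicit Types (s : seq (darc m n.+1)) (x : 'I_n.+1 -> R).

Let t s := tGamma (fun _ => alpha%:Z) s.

Definition reverse_mass x s : R := \sum_c (pminus l k s c)%:R * x c.

Lemma reverse_massE x s :
  reverse_mass x s = \sum_(e <- s) if e.1 then 0 else vec_sum l k x e.2.
Proof.
rewrite /reverse_mass; elim: s => [|e s IH].
  by rewrite big_nil big1 // => c _; rewrite mul0r.
rewrite big_cons -IH.
under eq_bigr do rewrite /pminus /= natrD mulrDl.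
rewrite big_split /=; congr (_ + _).
case: e => -[] a /=; first by rewrite big1 // => c _; rewrite mul0r.
rewrite /jumps; case: a => [i|j] /=.
  rewrite [RHS]big_mkcond; apply: eq_bigr => c _.
  by case: in_row; rewrite ?mul1r ?mul0r.
rewrite (bigD1 j) //= eqxx mul1r big1 ?addr0 // => c /negPf cj.
by rewrite eq_sym cj mul0r.
Qed.

Lemma no_reverse_rowsP s :
  no_reverse_row_arcs s = (nb_reverse_rows s == 0%N).
Proof.
rewrite /nb_reverse_rows -leqn0 leqNgt -has_count -all_predC.
by apply: eq_all => e /=; rewrite negb_and negbK.
Qed.

Lemma rev_row_sum_eq0 (b : 'I_m -> int) s :
  no_reverse_row_arcs s -> rev_row_sum b s = 0.
Proof.
move=> /allP h; rewrite /rev_row_sum big_seq_cond big1 // => e /andP[/h].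
by case: (e.1); case: is_row_arc.
Qed.

Lemma reverse_mass_ge0 x s : (forall c, 0 <= x c) -> 0 <= reverse_mass x s.
Proof. by move=> x0; apply: sumr_ge0 => c _; rewrite mulr_ge0. Qed.

Lemma gamma_ineqE (x : 'cV[R]_n.+1) s : no_reverse_row_arcs s ->
  let p := winding k s in
  gamma_ineq l k (fun _ => alpha%:Z) s x <->
  ((t s %% p)%Z * ((t s %/ p)%Z + 1))%:~R <=
    reverse_mass (fun c => x c 0) s + (t s %% p)%Z%:~R * \sum_c x c 0.
Proof.
move=> nr p; rewrite /gamma_ineq rev_row_sum_eq0 // addr0 -/(t s) -/p.
have -> : \sum_c ((pminus l k s c)%:Z + (t s %% p)%Z)%:~R * x c 0 =
    reverse_mass (fun c => x c 0) s + (t s %% p)%Z%:~R * \sum_c x c 0.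
  under eq_bigr do rewrite intrD mulrDl -pmulrn.
  by rewrite big_split /= -mulr_sumr.
by [].
Qed.

Lemma circuit_bound x s : is_circuit l k s -> no_reverse_row_arcs s ->
  (forall c, 0 <= x c) -> (forall i, alpha%:R <= vec_sum l k x (inl i)) ->
  (t s)%:~R <= (winding k s)%:~R * \sum_c x c + reverse_mass x s.
Proof.
move=> cs /allP nr x0 xr; rewrite mulrC mulrzr.
rewrite -(sum_arc_incr_winding (cumul_quasiperiodic x) cs) reverse_massE.
rewrite /t /tGamma rmorph_sum -big_split /= big_seq [leRHS]big_seq.
apply: ler_sum => e /nr; rewrite /arc_incr (cumul_incr l k_bounds).
by case: e => -[] [i|j] //= _; rewrite ?addr0 ?addNr // -pmulrn; apply: xr.
Qed.

Lemma gamma_ineq_integral (y : 'cV[R]_n.+1) (z : int) s :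
  is_circuit l k s -> no_reverse_row_arcs s -> 0 < winding k s ->
  (forall c, 0 <= y c 0) ->
  (forall i, alpha%:R <= vec_sum l k (fun c => y c 0) (inl i)) ->
  \sum_c y c 0 = z%:~R -> gamma_ineq l k (fun _ => alpha%:Z) s y.
Proof.
move=> cs nr p0 y0 yr yz; apply/gamma_ineqE => //.
have := circuit_bound cs nr y0 yr; rewrite yz.
have := reverse_mass_ge0 s y0; move: (reverse_mass _ _) => P P0.
have := divz_eq (t s) (winding k s); have := ltz_pmod (t s) p0.
have := modz_ge0 (t s) (lt0r_neq0 p0).
set b := (t s %/ _)%Z; set r := (t s %% _)%Z; set p := winding k s.
move=> r0 rp eu; rewrite eu intrD => bound.
suff : (r * (b + 1) - r * z)%:~R <= P by rewrite intrB [(r * z)%:~R]intrM; lra.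
have [zb|bz] := leP z b; last first.
  by apply: le_trans P0; rewrite lerz0 subr_le0 ler_wpM2l // lezD1.
have : (b * p + r - p * z)%:~R <= P by rewrite intrB intrD [(p * z)%:~R]intrM; lra.
apply: le_trans; rewrite ler_int.
have : 0 <= (p - r) * (b - z) by rewrite mulr_ge0 // subr_ge0 // ltW.
by lia.
Qed.

Variables (x : 'cV[R]_n.+1) (beta : int) (mu : R).
Hypothesis x_ge0 : forall c, 0 <= x c 0.
Hypothesis row_ge : forall i, alpha%:R <= vec_sum l k (fun c => x c 0) (inl i).
Hypothesis mu01 : 0 < mu < 1.
Hypothesis sum_x : \sum_c x c 0 = beta%:~R + mu.

Let v c := x c 0.

Lemma slice_weight_no_reverse_row s : no_reverse_row_arcs s ->
  \sum_(e <- s) slice_weight l k v alpha%:R mu 0 e =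
  (1 - mu) * (t s)%:~R - reverse_mass v s.
Proof.
move=> /allP nr; rewrite reverse_massE /t /tGamma rmorph_sum mulr_sumr -sumrB /=.
rewrite big_seq [RHS]big_seq; apply: eq_bigr => e /nr.
by case: e => -[] [i|j] //= _; rewrite ?subr0 ?mulr0 ?sub0r ?oppr0 // -pmulrn.
Qed.

(* With [r = t - beta p], the cases [r <= 0] and [p <= r] hold for every point of
   the slice; otherwise [beta] and [r] are the quotient and the remainder. *)
Lemma slice_circuit_le s : is_circuit l k s -> no_reverse_row_arcs s ->
  ((2 <= winding k s)%R -> ~~ (winding k s %| t s)%Z ->
    gamma_ineq l k (fun _ => alpha%:Z) s x) ->
  \sum_(e <- s) slice_weight l k v alpha%:R mu 0 e <=
    ((1 - mu) * beta%:~R) *~ winding k s.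
Proof.
move=> cs nr gam; have /andP[mu0 mu1] := mu01.
have nu0 : 0 < 1 - mu by rewrite subr_gt0.
rewrite (slice_weight_no_reverse_row nr) -(mulrzr ((1 - mu) * _)) -mulrA -intrM.
have := circuit_bound cs nr x_ge0 row_ge; rewrite sum_x -/v.
have := reverse_mass_ge0 s x_ge0; rewrite -/v.
move: gam; rewrite gamma_ineqE // sum_x -/v.
move: (reverse_mass v s) => P; set p := winding k s; set u := t s.
move=> gam P0 bound.
have [r uE] : exists r, u = beta * p + r.
  by exists (u - beta * p); rewrite addrC subrK.
suff : (1 - mu) * r%:~R <= P by rewrite uE intrD mulrDr; lra.
have [r0|r0] := leP r 0.
  by apply: le_trans P0; rewrite mulr_ge0_le0 ?lerz0 // ltW.
have [pr|rp] := leP p r.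
  rewrite -(@ler_int R) in pr.
  have : mu * p%:~R <= mu * r%:~R by rewrite ler_pM2l.
  by move: bound; rewrite uE intrD intrM; lra.
have p0 : 0 < p by exact: lt_trans rp.
have rE : (u %% p)%Z = r by rewrite uE modzMDl modz_small // ltW.
have bE : (u %/ p)%Z = beta.
  by rewrite uE divzMDl ?gt_eqF // divz_small ?addr0 //; lia.
move: gam; rewrite rE bE intrM intrD => gam.
have p2 : 2 <= p by lia.
have ndvd : ~~ (p %| u)%Z by apply/negP => /dvdz_mod0P h; move: r0; rewrite -rE h.
by have := gam p2 ndvd; lra.
Qed.

End GammaInequalities.

Lemma sum_short_incr (V : zmodType) (m n : nat) (l : 'I_m -> 'I_n.+1)
    (k : 'I_m -> nat) (B : V) (G : nat -> V) : quasiperiodic n B G ->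
  \sum_c (G (lift_head l k (inr c)) - G (lift_tail l (inr c))) = B.
Proof.
move=> per; rewrite -(sum_incr (quasiperiodic_shift n per)).
by apply: eq_bigr => c _; rewrite /lift_head /lift_tail /= addn1.
Qed.

Section Splitting.
Variables (R : archiRealFieldType) (m n : nat) (A : 'M[R]_(m, n.+1)).
Variables (l : 'I_m -> 'I_n.+1) (k : 'I_m -> nat) (alpha : nat).
Hypothesis cA : circular_data l k A.

Let b (i : 'I_m) := alpha%:Z.

Lemma Qpoly_rows (y : 'cV[R]_n.+1) :
  Qpoly A b y <-> (forall i, alpha%:R <= vec_sum l k (fun c => y c 0) (inl i)) /\
                  (forall c, 0 <= y c 0).
Proof.
by rewrite /Qpoly; split=> -[h ?]; split=> // i;
  have := h i; rewrite (circular_mulmx _ _ cA).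
Qed.

Lemma Qstar_of_potential (d : R) (beta : int) (G : nat -> R) :
  0 < d -> quasiperiodic n (d * beta%:~R) G ->
  (forall j, 0 <= G (lift_head l k (inr j)) - G (lift_tail l (inr j))) ->
  (forall i, d * alpha%:R <= G (lift_head l k (inl i)) - G (lift_tail l (inl i))) ->
  Qstar A b (\col_c (d^-1 * (G (lift_head l k (inr c)) - G (lift_tail l (inr c))))).
Proof.
move=> d0 per Gj Gi; apply: (@integral_slice _ _ _ _ _ _ _ _ beta cA); last first.
  under eq_bigr do rewrite mxE.
  by rewrite -mulr_sumr (sum_short_incr l k per) mulKf ?gt_eqF.
apply/Qpoly_rows; split=> [i|c]; last by rewrite mxE mulr_ge0 ?invr_ge0 // ltW.
rewrite /=; under eq_bigr do rewrite mxE.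
by rewrite -mulr_sumr -(row_incr l cA.1 i per) ler_pdivlMl.
Qed.

Hypothesis nd : no_dominating_rows A.

Lemma rows_not_included i j :
  i != j -> ~ (forall c, in_row l k i c -> in_row l k j c).
Proof.
move=> ij h; apply: (nd (i := j) (i' := i)); first by rewrite eq_sym.
move=> c; rewrite !cA.2; case: ifP => [/h -> //|_].
by case: ifP => _; rewrite ?ler01.
Qed.

Lemma Qstar_of_gamma_ineqs (x : 'cV[R]_n.+1) : Qpoly A b x ->
  (forall s, is_circuit l k s -> no_reverse_row_arcs s -> (2 <= winding k s)%R ->
     ~~ (winding k s %| tGamma b s)%Z -> gamma_ineq l k b s x) ->
  Qstar A b x.
Proof.
move=> xQ gam; have kb := cA.1; have [row_ge x_ge0] := (Qpoly_rows x).1 xQ.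
pose v c := x c 0; pose sigma := \sum_c v c.
have sigma_ge0 : 0 <= sigma by apply: sumr_ge0 => c _; apply: x_ge0.
pose beta := Num.floor sigma; pose mu := sigma - beta%:~R.
have /andP[mu_ge0 mu1] : 0 <= mu < 1.
  have /andP[h1 h2] := floor_itv sigma.
  by rewrite intrD in h2; rewrite /mu subr_ge0 h1 ltrBlDr addrC.
have sum_x : sigma = beta%:~R + mu by rewrite /mu addrC subrK.
have [mu0|mu0] := eqVneq mu 0.
  apply: (@integral_slice _ _ _ _ _ _ _ _ beta cA xQ).
  by rewrite -[LHS]/sigma sum_x mu0 addr0.
have mu_gt0 : 0 < mu by rewrite lt_def mu0.
have mu01 : 0 < mu < 1 by rewrite mu_gt0.
have nu_gt0 : 0 < 1 - mu by rewrite subr_gt0.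
have beta_ge0 : 0 <= beta%:~R :> R by rewrite ler0z floor_ge0.
have [s cs|H perH H_ge] := @slice_potential R m n l k v alpha%:R beta%:~R mu 0.
  move: s cs; apply: (reverse_row_circuits_redundant kb rows_not_included) => //.
  move=> s cs /eqP; rewrite -no_reverse_rowsP => nr.
  apply: slice_circuit_le => //; exact: gam.
pose K t := cumul v t - H t.
have K_per : quasiperiodic n (mu * (beta + 1)%:~R) K.
  move=> t; rewrite /K (cumul_quasiperiodic v) -/sigma perH sum_x intrD; ring.
have KE a : K (lift_head l k a) - K (lift_tail l a) =
    vec_sum l k v a - (H (lift_head l k a) - H (lift_tail l a)).
  by rewrite /K -(cumul_incr l kb); ring.
pose y : 'cV[R]_n.+1 :=
  \col_c ((1 - mu)^-1 * (H (lift_head l k (inr c)) - H (lift_tail l (inr c)))).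
pose z : 'cV[R]_n.+1 :=
  \col_c (mu^-1 * (K (lift_head l k (inr c)) - K (lift_tail l (inr c)))).
have -> : x = (1 - mu) *: y + mu *: z.
  by apply/colP => c; rewrite !mxE !mulVKf ?gt_eqF // KE addrC subrK.
apply: conv_hull_convex; rewrite ?subrK ?ltW //.
- apply: (Qstar_of_potential nu_gt0 perH) => [j|i].
    exact: (H_ge (true, inr j)).
  exact: (H_ge (true, inl i)).
- apply: (Qstar_of_potential mu_gt0 K_per) => [j|i]; rewrite KE.
    have := H_ge (false, inr j).
    by rewrite /arc_incr /= lerN2 subr_ge0.
  have := H_ge (false, inl i); rewrite /arc_incr /= subr0.
  by rewrite lerBlDr lerBrDr addrC; lra.
Qed.

Lemma gamma_ineq_of_Qstar (x : 'cV[R]_n.+1) s : Qstar A b x ->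
  is_circuit l k s -> no_reverse_row_arcs s -> 0 < winding k s ->
  gamma_ineq l k b s x.
Proof.
move=> xQ cs nr p0; apply: conv_hull_ge xQ => y [/Qpoly_rows[row_ge y_ge0] yint].
have e : \sum_c y c 0 = (Num.floor (\sum_c y c 0))%:~R by rewrite floorK ?rpred_sum.
exact (gamma_ineq_integral cA.1 cs nr p0 y_ge0 row_ge e).
Qed.

End Splitting.

Lemma Qpoly_of_Qstar (R : archiNumDomainType) (m n : nat) (A : 'M[R]_(m, n))
    (b : 'I_m -> int) x : Qstar A b x -> Qpoly A b x.
Proof.
move=> xQ; split=> [i|j].
  rewrite mxE; apply: conv_hull_ge xQ => y [[/(_ i) h _] _].
  by move: h; rewrite mxE.
have deltaE (y : 'cV[R]_n) : \sum_c (c == j)%:R * y c 0 = y j 0.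
  rewrite (bigD1 j) //= eqxx mul1r big1 ?addr0 // => c /negPf->.
  by rewrite mul0r.
by rewrite -deltaE; apply: conv_hull_ge xQ => y [[_ h] _]; rewrite deltaE.
Qed.

Theorem theorem5p3 (R : realType) (m n : nat) (A : 'M[R]_(m, n))
    (l : 'I_m -> 'I_n) (k : 'I_m -> nat) (alpha : nat) :
  circular_data l k A ->
  no_dominating_rows A ->
  (0 < alpha)%N ->
  forall x : 'cV[R]_n,
    Qstar A (fun _ => alpha%:Z) x <->
    (Qpoly A (fun _ => alpha%:Z) x /\
     forall s : seq (darc m n),
       is_circuit l k s ->
       no_reverse_row_arcs s ->
       (2 <= winding k s)%R ->
       ~~ (winding k s %| tGamma (fun _ => alpha%:Z) s)%Z ->
       gamma_ineq l k (fun _ => alpha%:Z) s x).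
Proof.
case: n A l => [|n] A l cA nd _ x.
  split=> [xQ|[xQ _]].
    split; first exact: Qpoly_of_Qstar.
    move=> [|[b [i|[]//]] s]; first by case.
    by case: (l i).
  exists 1%N, (fun=> x), (fun=> 1); split=> //.
  - by move=> _; split=> // -[].
  - by rewrite big_ord1.
  - by rewrite big_ord1 scale1r.
split=> [xQ|[xQ gam]]; last exact: Qstar_of_gamma_ineqs gam.
split; first exact: Qpoly_of_Qstar.
move=> s cs nr p2 _; apply: (gamma_ineq_of_Qstar cA) => //.
exact: lt_le_trans p2.
Qed.
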